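(* Suppose the standing assumptions on $f,R,T$ and the inner approximation property stated in the context hold. Let $w^k\in\operatorname{dom}\varphi$ with $\chi_k:=\chi(w^k)>0$, let $B_k:W\to W$ be bounded, linear and self-adjoint, and let $\Delta_k>0$. Then the geometric Cauchy search (stated in the context) terminates after finitely many inner iterations and parameter reductions. Its returned point $w^k+s_k^{\rm C}$ belongs to $\operatorname{dom}\varphi$, and $$\operatorname{pred}_k(s_k^{\rm C})\ge\kappa_{\rm C}\,\chi_k\min\Bigl\{\frac{\chi_k}{1+\|B_k\|},\Delta_k\Bigr\},\qquad \kappa_{\rm C}=\frac{(1-\sigma)\min\{\tau,\zeta(1-\sigma)\}}{2(1+\sigma)^2}>0 .$$
   Context: $W$ is a real Hilbert space with inner product $(\cdot,\cdot)_W$; $X$ is a real Banach space with continuous dual $X^*$; $T:W\to X$ is bounded and linear with Banach adjoint $T^*:X^*\to W^*$. $\|\ell\|_{W^*}=\|\mathcal R_W^{-1}\ell\|_W$ with $\mathcal R_W:W\to W^*$ the Riesz map. Standing assumptions: $R:X\to(-\infty,+\infty]$ is proper, convex, norm lower semicontinuous; $\varphi=R\circ T$, $\operatorname{dom}\varphi\ne\emptyset$; $f:W\to\mathbb R$ is continuously Fréchet differentiable with Hilbert gradient $\nabla f$ (i.e. $(\nabla f(w),v)_W=f'(w)[v]$) globally Lipschitz with constant $L_f\ge0$; $F=f+\varphi$ is bounded below on $\operatorname{dom}\varphi$ by a finite $F_{\rm low}$. Fixed parameters: $\tau>0$, $0<\sigma<1$, $0<\zeta<1$. $p(w;t)=\arg\min_{s\in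 W}\{(\nabla f(w),s)_W+\frac1{2t}\|s\|_W^2+\varphi(w+s)\}$ (unique), and $\chi(w)=\frac1\tau\|p(w;\tau)\|_W$. For $q\in W$, $t>0$: $\Psi_{q,t}(y)=\frac1{2t}\|y-q\|_W^2+R(Ty)$, $D_{q,t}(\mu)=\langle\mu,Tq\rangle-\frac t2\|T^*\mu\|_{W^*}^2-R^*(\mu)$, $R^*(\mu)=\sup_{x\in X}(\langle\mu,x\rangle-R(x))$, gap $\mathcal G_{q,t}(y,\mu)=\Psi_{q,t}(y)-D_{q,t}(\mu)$, finite when $Ty\in\operatorname{dom}R$, $\mu\in\operatorname{dom}R^*$. Inner approximation property: for every requested $w\in\operatorname{dom}\varphi$ and $t>0$, with $q=w-t\nabla f(w)$, the inner procedure produces a sequence of pairs $(y^j,\mu^j)\in W\times X^*$ with finite gaps and $\mathcal G_{q,t}(y^j,\mu^j)\to0$, together with available numbers $\overline{\mathcal G}_j\ge\mathcal G_{q,t}(y^j,\mu^j)$, $\overline{\mathcal G}_j\to0$, used in all tests ($\overline{\mathcal G}_j$ is either the gap itself or a rigorous upper bound for it). The pair $(s,\mu)=(y^j-w,\mu^j)$ passes the relative test at $(w,t)$ if $\overline{\mathcal G}_j\le\frac{\sigma^2}{2t}\|s\|_W^2$. Model: $m_k(s)=f(w^k)+(\nabla f(w^k),s)_W+\frac12(B_ks,s)_W+\varphi(w^k+s)$ and $\operatorname{pred}_k(s)=m_k(0)-m_k(s)$. Geometric Cauchy search: set $\bar t_k=\min\{\tau,(1-\sigma)/(1+\|B_k\|)\}$.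 For $j=0,1,\dots$ let $t_{k,j}=\zeta^j\bar t_k$, and run the inner procedure at $(w^k,t_{k,j})$ until a pair $(s_{k,j},\mu_{k,j})$ passes the relative test at $(w^k,t_{k,j})$. Return the step $s_k^{\rm C}=s_{k,j}$ and parameter $t_k=t_{k,j}$ for the first $j$ with $\|s_{k,j}\|_W\le\Delta_k$. *)

(* Defs.v *)
From HB Require Import structures.
From mathcomp Require Export all_boot all_order all_algebra.
From mathcomp Require Export all_classical all_reals all_analysis.

Set Implicit Arguments.
Unset Strict Implicit.
Unset Printing Implicit Defensive.

Import Order.TTheory GRing.Theory Num.Theory.
Export numFieldNormedType.Exports.

Local Open Scope classical_set_scope.
Local Open Scope ring_scope.

Section normed_spaces.
Context {K : realType}.

Record cdual (V : normedModType K) := CDual {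
  cdual_fun :> {linear V -> K^o} ;
  cdual_continuous : continuous cdual_fun }.

(* Meaningful for bounded linear maps; [sup] is 0 on unbounded sets. *)
Definition opnorm (U V : normedModType K) (A : U -> V) : K :=
  sup [set `|A u| | u in [set u | `|u| <= 1]].

Definition continuously_differentiable (V : normedModType K) (f : V -> K^o) :=
  (forall v, differentiable f v) /\
  (forall v, opnorm (fun h => 'd f u h - 'd f v h) @[u --> v] --> (0 : K)).

End normed_spaces.

Section extended_valued.
Context {K : realType} {V : normedModType K}.
Implicit Types g : V -> \bar K.

Definition edom g : set V := [set v | (g v < +oo)%E].

Definition proper_fun g := (forall v, g v != -oo%E) /\ edom g !=set0.

(* At [a = 0] or [a = 1] this relies on [0 * +oo = 0]. *)
Definition econvex g := forall (a : K) (u v : V), 0 <= a <= 1 ->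
  (g (a *: u + (1 - a) *: v)%R <= a%:E * g u + (1 - a)%:E * g v)%E.

Definition conjugate g (mu : cdual V) : \bar K :=
  ereal_sup (range (fun v => (mu v : K)%:E - g v)%E).

Definition is_argmin g (v : V) := forall u, (g v <= g u)%E.

End extended_valued.

Section hilbert.
Context {K : realType} {W : completeNormedModType K}.
Variable ip : {dot W for idfun}.

Definition induces_norm := forall w : W, ip w w = `|w| ^+ 2.

Definition riesz (w : W) : W -> K := fun v => ip w v.

Definition riesz_inv (l : W -> K) : W := xget 0 [set w | riesz w = l].

Definition hdual_norm (l : W -> K) : K := `|riesz_inv l|.

Definition is_gradient (f : W -> K^o) (gradf : W -> W) :=
  forall w v, ip (gradf w) v = 'd f w v.

Definition self_adjoint (B : W -> W) := forall u v, ip (B u) v = ip u (B v).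

End hilbert.

Section composite.
Context {K : realType} {W X : completeNormedModType K}.
Variables (ip : {dot W for idfun}) (T : W -> X) (R : X -> \bar K).
Variables (f : W -> K^o) (gradf : W -> W).

Definition phi (w : W) : \bar K := R (T w).

Definition prox_objective (w : W) (t : K) (s : W) : \bar K :=
  ((ip (gradf w) s + (2 * t)^-1 * `|s| ^+ 2)%:E + phi (w + s)%R)%E.

Definition prox_step (w : W) (t : K) : W :=
  xget 0 [set s | is_argmin (prox_objective w t) s].

Definition chi (tau : K) (w : W) : K := tau^-1 * `|prox_step w tau|.

Definition adjoint (mu : cdual X) : W -> K := fun v => mu (T v).

Definition Psi (q : W) (t : K) (y : W) : \bar K :=
  (((2 * t)^-1 * `|y - q| ^+ 2)%:E + R (T y))%E.

Definition dual_value (q : W) (t : K) (mu : cdual X) : \bar K :=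
  (((mu (T q) : K) - t / 2 * hdual_norm ip (adjoint mu) ^+ 2)%:E - conjugate R mu)%E.

Definition gap (q : W) (t : K) (y : W) (mu : cdual X) : \bar K :=
  (Psi q t y - dual_value q t mu)%E.

Definition model (B : W -> W) (w s : W) : \bar K :=
  (((f w : K) + ip (gradf w) s + 2^-1 * ip (B s) s)%:E + phi (w + s)%R)%E.

Definition pred_decrease (B : W -> W) (w s : W) : \bar K :=
  (model B w 0%R - model B w s)%E.

End composite.

Section inner.
Context {K : realType} {W X : completeNormedModType K}.

Record inner_output := InnerOutput {
  primal : nat -> W ;
  multiplier : nat -> cdual X ;
  gap_bound : nat -> K }.

Definition inner_approximation (ip : {dot W for idfun}) (T : W -> X)
    (R : X -> \bar K) (gradf : W -> W) (inner : W -> K -> inner_output) :=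
  forall (w : W) (t : K), edom (phi T R) w -> 0 < t ->
  let o := inner w t in
  let G j := gap ip T R (w - t *: gradf w) t (primal o j) (multiplier o j) in
  [/\ forall j, G j \is a fin_num,
      G j @[j --> \oo] --> 0%E,
      forall j, (G j <= (gap_bound o j)%:E)%E &
      gap_bound o j @[j --> \oo] --> (0 : K)].

Definition relative_test (sigma : K) (w : W) (t : K) (o : inner_output)
    (j : nat) : bool :=
  gap_bound o j <= sigma ^+ 2 / (2 * t) * `|primal o j - w| ^+ 2.

End inner.
Arguments inner_output {K} W X.

Definition first_index (P : pred nat) (n : nat) :=
  P n /\ forall m, (m < n)%N -> ~~ P m.

Section cauchy_search.
Context {K : realType} {W X : completeNormedModType K}.
Variables (tau sigma zeta : K) (inner : W -> K -> inner_output W X).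
Variables (B : W -> W) (Delta : K) (w : W).

Definition cauchy_param (j : nat) : K :=
  zeta ^+ j * Num.min tau ((1 - sigma) / (1 + opnorm B)).

(* The pair accepted at parameter [cauchy_param j], when the inner run there
   is stopped at inner index [i]. *)
Definition cauchy_step (j i : nat) : W :=
  primal (inner w (cauchy_param j)) i - w.

(* A complete finite execution: for every tried parameter index [j <= J] the
   inner run stops at inner index [n j], the first one whose pair passes the
   relative test, and [J] is the first parameter index whose accepted step fits
   in the trust region.  Values [n j] with [J < j] play no role. *)
Definition cauchy_search_run (J : nat) (n : nat -> nat) :=
  (forall j, (j <= J)%N ->
     first_index (relative_test sigma w (cauchy_param j)
                    (inner w (cauchy_param j))) (n j)) /\
  first_index (fun j => `|cauchy_step j (n j)| <= Delta) J.

End cauchy_search.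

Definition kappa_C {K : realType} (tau sigma zeta : K) : K :=
  (1 - sigma) * Num.min tau (zeta * (1 - sigma)) / (2 * (1 + sigma) ^+ 2).

(* Main.v *)
Require Import Defs.
From mathcomp Require Import ring lra.

Set Implicit Arguments.
Unset Strict Implicit.
Unset Printing Implicit Defensive.

Import Order.TTheory GRing.Theory Num.Theory.
Local Open Scope classical_set_scope.
Local Open Scope ring_scope.

(**
Write p(t) for the exact proximal step at w, let q = w - t grad f(w), and let
y = w + s be the primal point of an accepted pair.

The objective Psi_{q,t} is (1/t)-strongly convex, so the exact point w + p(t)
exists and Psi_{q,t} exceeds its minimum at y by at least
|s - p(t)|^2 / (2t) ([moreau_has_argmin], [moreau_growth]).  By Fenchel weak
duality the gap bounds this excess from above ([weak_duality],
[Psi_le_gap]).  The relative test therefore gives |s - p(t)| <= sigma |s|,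
whence (1 - sigma) |s| <= |p(t)| <= (1 + sigma) |s|.

Decrease.  With phi = R o T,
  phi(w) - phi(w+s) - (grad f(w), s) = Psi(w) - Psi(y) + |s|^2 / (2t).
Strong convexity at the minimizer gives
Psi(w) >= min Psi + |p(t)|^2 / (2t), and the test gives
Psi(y) <= min Psi + sigma^2 |s|^2 / (2t).  Since
(1 - sigma)^2 + 1 - sigma^2 = 2 (1 - sigma), the difference above is at least
(1 - sigma) |s|^2 / t ([accepted_decrease]).  The initial parameter of the
search is small enough for the curvature term (B s, s) / 2 to eat at most half
of it, so the predicted decrease is at least (1 - sigma) |s|^2 / (2t).

Length of the step.  The ratio |p(t)| / t is nonincreasing in t
([prox_step_ratio_nonincreasing]), so |p(t)| >= t chi for t <= tau.  If the
first parameter is returned, this bounds |s| below in terms of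
chi / (1 + |B|).  Otherwise the previous parameter t / zeta was rejected, so
|p(t / zeta)| > (1 - sigma) Delta, and monotonicity of the ratio gives
|p(t)| > zeta (1 - sigma) Delta ([cauchy_step_lower_bound]).

Termination.  At a fixed t <= tau the iterates converge to w + p(t), and
p(t) <> 0 because chi > 0, so the right-hand side of the test stays away from
zero while the gap bound vanishes ([inner_run_stops]).  Since p(t) -> 0 as
t -> 0 ([prox_step_small]), some parameter yields a step inside the trust
region.

The Riesz representation of T^* mu, needed in weak duality because the dual
norm is defined through it, comes from the same existence theorem: the
minimizer of |v|^2 / 2 - l(v) represents l.
*)

(** * Real inner products *)

Section inner_product.
Context {K : realType} {W : completeNormedModType K}.
Variable ip : {dot W for idfun}.
Hypothesis ip_norm : induces_norm ip.

Lemma ipC u v : ip u v = ip v u.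
Proof. by rewrite hermC expr0 mul1r. Qed.

Lemma ipDl u v x : ip (u + v) x = ip u x + ip v x.
Proof. exact: linearDl. Qed.

Lemma ipDr u v x : ip x (u + v) = ip x u + ip x v.
Proof. by rewrite ipC ipDl !(ipC x). Qed.

Lemma ipZl a u x : ip (a *: u) x = a * ip u x.
Proof. exact: linearZl_LR. Qed.

Lemma ipZr a u x : ip x (a *: u) = a * ip x u.
Proof. by rewrite ipC ipZl ipC. Qed.

Lemma ipNl u x : ip (- u) x = - ip u x.
Proof. by rewrite -scaleN1r ipZl mulN1r. Qed.

Lemma ipNr u x : ip x (- u) = - ip x u.
Proof. by rewrite ipC ipNl ipC. Qed.

Lemma ip0r x : ip x 0 = 0.
Proof. by rewrite -(subrr x) ipDr ipNr subrr. Qed.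

Definition ipE := (ipDl, ipDr, ipNl, ipNr, ipZl, ipZr).

Lemma sqr_normD u v : `|u + v| ^+ 2 = `|u| ^+ 2 + 2 * ip u v + `|v| ^+ 2.
Proof. by rewrite -!ip_norm !ipE (ipC v u); ring. Qed.

Lemma sqr_normB u v : `|u - v| ^+ 2 = `|u| ^+ 2 - 2 * ip u v + `|v| ^+ 2.
Proof. by rewrite -!ip_norm !ipE (ipC v u); ring. Qed.

(** Expand | |v| u - |u| v |^2 >= 0. *)
Lemma Cauchy_Schwarz u v : ip u v <= `|u| * `|v|.
Proof.
have [/eqP|uv_neq0] := eqVneq (`|u| * `|v|) 0.
  rewrite mulf_eq0 !normr_eq0 => /orP[]/eqP->.
    by rewrite ipC ip0r normr0 mul0r.
  by rewrite ip0r normr0 mulr0.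
have uv_gt0 : 0 < `|u| * `|v| by rewrite lt0r uv_neq0 mulr_ge0.
have : 0 <= `|(`|v| *: u - `|u| *: v)| ^+ 2 by exact: sqr_ge0.
rewrite sqr_normB !normrZ !normr_id !ipE => h.
rewrite -(ler_pM2l uv_gt0).
nra.
Qed.

Lemma sqr_norm_conv a (u v q : W) :
  `|a *: u + (1 - a) *: v - q| ^+ 2 =
  a * `|u - q| ^+ 2 + (1 - a) * `|v - q| ^+ 2 - a * (1 - a) * `|u - v| ^+ 2.
Proof.
by rewrite -!ip_norm !ipE (ipC v u) (ipC q u) (ipC q v); ring.
Qed.

End inner_product.

(** * Real and extended real inequalities *)

(** Testing finite upper bounds only lets every estimate on extended-valued
functions below be carried out in the reals. *)
Lemma lee_upper_bounds {K : realType} (b : K) (x : \bar K) :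
  (forall a : K, (x <= a%:E)%E -> b <= a) -> (b%:E <= x)%E.
Proof.
case: x => [r h|_|h].
- by rewrite lee_fin h.
- by rewrite leey.
- by have := h (b - 1) (leNye _); rewrite lerBrDr gerDl ler10.
Qed.

Lemma le_of_shrink {K : realFieldType} (c d : K) :
  (forall l, 0 < l < 1 -> (1 - l) * c <= d) -> c <= d.
Proof.
move=> step; rewrite leNgt; apply/negP => dc.
have := step 2^-1 ltac:(lra) => half.
have c_gt0 : 0 < c by lra.
have c2_gt0 : 0 < 2 * c by rewrite mulr_gt0.
have l01 : 0 < (c - d) / (2 * c) < 1.
  by rewrite divr_gt0//= ?ltr_pdivrMr//; lra.
have := step _ l01.
have -> : (1 - (c - d) / (2 * c)) * c = (c + d) / 2 by field; rewrite gt_eqF.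
lra.
Qed.

(** Room strictly between the two sides, used to pass from strict inequalities
at a point to neighbourhoods of it. *)
Lemma EFin_lt_between {K : realFieldType} (a : K) (x : \bar K) :
  (a%:E < x)%E -> exists2 c, a < c & (c%:E < x)%E.
Proof.
case: x => [r|_|]; last by rewrite ltNge leNye.
  by rewrite lte_fin => ar; exists ((a + r) / 2); rewrite ?lte_fin; lra.
by exists (a + 1); rewrite ?ltry// ltrDl.
Qed.

(** * Convex lower semicontinuous functions *)

Section convex.
Context {K : realType} {W : completeNormedModType K}.
Implicit Types g : W -> \bar K.

Lemma econvex_le g : econvex g -> forall (l a b : K) u v, 0 <= l <= 1 ->
  (g u <= a%:E)%E -> (g v <= b%:E)%E ->
  (g (l *: u + (1 - l) *: v)%R <= (l * a + (1 - l) * b)%:E)%E.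
Proof.
move=> gconv l a b u v l01 ga gb; apply: le_trans (gconv _ _ _ l01) _.
case/andP: l01 => l0 l1.
by rewrite (EFinD (l * a)) !EFinM leeD// lee_wpmul2l// lee_fin subr_ge0.
Qed.

(** Lower semicontinuity bounds g below by g w - 1 on a ball around w.  A value
of g far away that is too low would, by convexity along the segment to w, push
g below that bound inside the ball; hence g decreases at most linearly. *)
Lemma econvex_lsc_minorant g (w : W) (c : K) :
  econvex g -> lower_semicontinuous g -> g w = c%:E ->
  exists2 C : K, 0 <= C & forall u, ((c - C * (1 + `|u - w|))%:E <= g u)%E.
Proof.
move=> gconv glsc gw.
have [|V /nbhs_normP[r /= r_gt0 rV] gV] := glsc w (c - 1).
  by rewrite gw lte_fin; lra.
have {rV gV} near_w u : `|u - w| < r -> ((c - 1)%:E < g u)%E.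
  by move=> ur; apply/gV/rV; rewrite /= distrC.
exists (1 + 2 / r); first by rewrite addr_ge0// divr_ge0// ltW.
move=> u; apply: lee_upper_bounds => a gua.
have [ur|ru] := ltP `|u - w| r.
  have := lt_le_trans (near_w _ ur) gua; rewrite lte_fin.
  have : 0 <= 2 / r by rewrite divr_ge0// ltW.
  have := normr_ge0 (u - w); nra.
set d := `|u - w| in ru *.
have d_gt0 : 0 < d by exact: lt_le_trans ru.
(* the point of the segment from w to u at distance r / 2 from w *)
have l01 : 0 <= r / (2 * d) <= 1.
  apply/andP; split; first by rewrite divr_ge0// ?mulr_ge0// ltW.
  by rewrite ler_pdivrMr ?mulr_gt0//; lra.
have gw' : (g w <= c%:E)%E by rewrite gw.
have := econvex_le gconv l01 gua gw'.
have dist : `|r / (2 * d) *: u + (1 - r / (2 * d)) *: w - w| < r.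
  have -> : r / (2 * d) *: u + (1 - r / (2 * d)) *: w - w =
            (r / (2 * d)) *: (u - w).
    by rewrite scalerBl scale1r scalerBr addrA addrAC addrK.
  case/andP: l01 => l0 _; rewrite normrZ ger0_norm// -/d.
  have -> : r / (2 * d) * d = r / 2 by field; rewrite gt_eqF.
  by clear -r_gt0; lra.
move=> /(lt_le_trans (near_w _ dist)); rewrite lte_fin => la.
have slope : c - a < 2 / r * d.
  have l_gt0 : 0 < r / (2 * d) by rewrite divr_gt0 ?mulr_gt0.
  rewrite -(ltr_pM2l l_gt0).
  have -> : r / (2 * d) * (2 / r * d) = 1 by field; rewrite !gt_eqF.
  lra.
have : 0 < 2 / r by rewrite divr_gt0.
lra.
Qed.

(** The function minimized in the Moreau envelope of g.  [Psi T R] is this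
function for [g := phi T R]; the Riesz theorem uses it for a linear g. *)
Definition moreau g (q : W) (t : K) (y : W) : \bar K :=
  (((2 * t)^-1 * `|y - q| ^+ 2)%:E + g y)%E.

End convex.

(** * Existence of proximal points *)

Section moreau.
Context {K : realType} {W : completeNormedModType K}.
Variable ip : {dot W for idfun}.
Hypothesis ip_norm : induces_norm ip.
Variables (g : W -> \bar K) (t : K) (q : W).
Hypotheses (g_convex : econvex g) (t_gt0 : 0 < t).

Let t2_gt0 : 0 < (2 * t)^-1. Proof. by rewrite invr_gt0 mulr_gt0. Qed.

Lemma moreau_leE y a :
  (moreau g q t y <= a%:E)%E = (g y <= (a - (2 * t)^-1 * `|y - q| ^+ 2)%:E)%E.
Proof. by rewrite /moreau addeC -leeBrDr// EFinB. Qed.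

(** Strong convexity of modulus 1 / t; the quadratic gain is the identity
[sqr_norm_conv]. *)
Lemma moreau_conv_le l a b u v : 0 <= l <= 1 ->
  (moreau g q t u <= a%:E)%E -> (moreau g q t v <= b%:E)%E ->
  (moreau g q t (l *: u + (1 - l) *: v)%R <=
   (l * a + (1 - l) * b - l * (1 - l) * ((2 * t)^-1 * `|u - v| ^+ 2))%:E)%E.
Proof.
move=> l01; rewrite !moreau_leE (sqr_norm_conv ip_norm) => gu gv.
apply: le_trans (econvex_le g_convex l01 gu gv) _.
by rewrite lee_fin le_eqVlt; apply/orP; left; apply/eqP; ring.
Qed.

(** Compare p with l y + (1 - l) p in the strong convexity inequality, divide by
l and let l tend to 0. *)
Lemma moreau_growth p b y : is_argmin (moreau g q t) p ->
  moreau g q t p = b%:E ->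
  ((b + (2 * t)^-1 * `|y - p| ^+ 2)%:E <= moreau g q t y)%E.
Proof.
move=> p_min pb; apply: lee_upper_bounds => a ya.
set c := (2 * t)^-1 * `|y - p| ^+ 2.
have c_ge0 : 0 <= c by rewrite mulr_ge0 ?sqr_ge0// ltW.
have step l : 0 < l < 1 -> (1 - l) * c <= a - b.
  case/andP=> l0 l1; have l01 : 0 <= l <= 1 by rewrite !ltW.
  have pb' : (moreau g q t p <= b%:E)%E by rewrite pb.
  have := le_trans (p_min _) (moreau_conv_le l01 ya pb').
  rewrite pb lee_fin -/c => h.
  rewrite -(ler_pM2l l0); clear -h; nra.
by rewrite addrC -lerBrDr; exact: le_of_shrink.
Qed.

Hypothesis g_lsc : lower_semicontinuous g.

(** The quadratic term absorbs the linear decrease allowed by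
[econvex_lsc_minorant]. *)
Lemma moreau_bounded_below w c : g w = c%:E ->
  exists m, forall y, (m%:E <= moreau g q t y)%E.
Proof.
move=> gw; have [C C0 minor] := econvex_lsc_minorant g_convex g_lsc gw.
exists (c - C * (1 + `|q - w|) - t / 2 * C ^+ 2) => y.
apply: lee_upper_bounds => a; rewrite moreau_leE => /(le_trans (minor y)).
rewrite lee_fin.
have tri : `|y - w| <= `|y - q| + `|q - w| by exact: ler_distD.
set d := `|y - q| in tri *; set e := `|y - w| in tri *; set r := `|q - w| in tri *.
have : 0 <= (2 * t)^-1 * (d - t * C) ^+ 2 by rewrite mulr_ge0 ?sqr_ge0// ltW.
have -> : (2 * t)^-1 * (d - t * C) ^+ 2 = (2 * t)^-1 * d ^+ 2 - C * d + t / 2 * C ^+ 2.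
  by field; rewrite gt_eqF.
have : C * e <= C * (d + r) by rewrite ler_wpM2l.
clear; lra.
Qed.

(** Strong convexity at the midpoint of two almost-minimizers: this makes
minimizing sequences Cauchy. *)
Lemma moreau_minimizing_dist m eps u v : (forall y, (m%:E <= moreau g q t y)%E) ->
  (moreau g q t u <= (m + eps)%:E)%E -> (moreau g q t v <= (m + eps)%:E)%E ->
  `|u - v| ^+ 2 <= 8 * t * eps.
Proof.
move=> m_le ule vle.
have h01 : 0 <= (2^-1 : K) <= 1 by lra.
have := le_trans (m_le _) (moreau_conv_le h01 ule vle).
rewrite lee_fin => h.
have : (2 * t)^-1 * `|u - v| ^+ 2 <= 4 * eps by move: h; clear m_le ule vle; lra.
rewrite -(ler_pM2l (x := 2 * t)) ?mulr_gt0// mulVKf ?gt_eqF ?mulr_gt0//.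
lra.
Qed.

Lemma moreau_lsc : lower_semicontinuous (moreau g q t).
Proof.
move=> y a ay.
have : ((a - (2 * t)^-1 * `|y - q| ^+ 2)%:E < g y)%E.
  by rewrite ltNge -moreau_leE -ltNge.
move=> /EFin_lt_between[c ac /g_lsc[V Vy gV]].
pose quad u := (2 * t)^-1 * `|u - q| ^+ 2.
have quad_cont : {for y, continuous quad}.
  apply: cvgM; first exact: cvg_cst.
  have norm_cvg : `|u - q| @[u --> y] --> `|y - q|.
    apply: cvg_norm; apply: (cvgB (f := id) (g := cst q)); first exact: cvg_id.
    exact: cvg_cst.
  exact: (cvgM norm_cvg norm_cvg).
have quad_near : nbhs y [set u | a - c < quad u].
  by apply: (cvgr_gt _ quad_cont); rewrite ltrBlDr -ltrBlDl.
exists (V `&` [set u | a - c < quad u]); first exact: filterI.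
move=> u [/gV cu /= au].
rewrite ltNge moreau_leE -ltNge; apply: lt_trans cu.
by rewrite lte_fin -/(quad u) ltrBlDr -ltrBlDl.
Qed.

(** A minimizing sequence is Cauchy, its limit exists because W is complete, and
lower semicontinuity shows that the infimum is attained there. *)
Lemma moreau_has_argmin w c : g w = c%:E -> exists p, is_argmin (moreau g q t) p.
Proof.
move=> gw; have [m0 m0_le] := moreau_bounded_below gw.
pose A := [set a : K | exists y, (moreau g q t y <= a%:E)%E].
have A_inf : has_inf A.
  split; first by exists ((2 * t)^-1 * `|w - q| ^+ 2 + c), w; rewrite /moreau gw.
  by exists m0 => a [y] /(le_trans (m0_le y)); rewrite lee_fin.
pose m := inf A.
have m_le y : (m%:E <= moreau g q t y)%E.
  apply: lee_upper_bounds => a ya; apply: ge_inf; last by exists y.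
  exact: A_inf.2.
have /choice[y yP] : forall n : nat, exists y,
    (moreau g q t y <= (m + n.+1%:R^-1)%:E)%E.
  move=> n; have n_gt0 : 0 < n.+1%:R^-1 :> K by rewrite invr_gt0.
  have [a [z za] am] := inf_adherent n_gt0 A_inf.
  by exists z; rewrite (le_trans za)// lee_fin ltW.
have near_min eps : 0 < eps ->
    \forall n \near \oo, (moreau g q t (y n) <= (m + eps)%:E)%E.
  move=> e0; near=> n; apply: le_trans (yP n) _; rewrite lee_fin lerD2l.
  by apply: ltW; near: n; exact: near_infty_natSinv_lt (PosNum e0).
have y_cvg : cvgn y.
  apply/cauchy_cvgP/cauchy_exP => e e0.
  have eps0 : 0 < e ^+ 2 / (16 * t) by rewrite divr_gt0 ?exprn_gt0 ?mulr_gt0.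
  have [N _ NP] := near_min _ eps0.
  exists (y N), N => // n Nn; rewrite /= -ball_normE /=.
  rewrite -(ltr_pXn2r (n := 2)) ?nnegrE ?(ltW e0)//.
  apply: le_lt_trans (moreau_minimizing_dist m_le (NP _ (leqnn N)) (NP _ Nn)) _.
  have -> : 8 * t * (e ^+ 2 / (16 * t)) = e ^+ 2 / 2 by field; rewrite gt_eqF.
  by rewrite ltr_pdivrMr// ltr_pMr ?exprn_gt0// ltr1n.
exists (lim (y @ \oo)) => u; apply: le_trans (m_le u).
rewrite leNgt; apply/negP => /EFin_lt_between[a ma /moreau_lsc[V Vp aV]].
have ma0 : 0 < a - m by rewrite subr_gt0.
have y_V : \forall n \near \oo, V (y n) by exact: y_cvg.
have [n [/= /aV an]] := filter_ex (filterI y_V (near_min _ ma0)).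
by rewrite addrC subrK => /(lt_le_trans an); rewrite ltxx.
Unshelve. all: by end_near. Qed.

End moreau.

(** * Operator norm *)

Lemma opnorm_has_ubound {K : realType} {U V : normedModType K}
    (A : {linear U -> V}) : bounded_near A (nbhs 0) ->
  has_ubound [set `|A u| | u in [set u | `|u| <= 1]].
Proof.
move=> /linear_boundedP /pinfty_ex_gt0[M M_gt0 AM].
exists M => _ [v /= v1 <-]; rewrite (le_trans (AM v))//.
by rewrite -[leRHS]mulr1 ler_pM2l.
Qed.

Lemma opnorm_ge0 {K : realType} {U V : normedModType K} (A : {linear U -> V}) :
  bounded_near A (nbhs 0) -> 0 <= opnorm A.
Proof.
move=> /opnorm_has_ubound ub; apply: ub_le_sup => //.
by exists 0; rewrite /= ?normr0 ?linear0 ?normr0.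
Qed.

Lemma opnorm_ge {K : realType} {U V : normedModType K} (A : {linear U -> V}) u :
  bounded_near A (nbhs 0) -> `|A u| <= opnorm A * `|u|.
Proof.
move=> /opnorm_has_ubound ub.
have [->|u_neq0] := eqVneq u 0; first by rewrite linear0 !normr0 mulr0.
have u_gt0 : 0 < `|u| by rewrite normr_gt0.
rewrite -ler_pdivrMr// mulrC -{1}(gtr0_norm u_gt0) -normfV -normrZ -linearZ.
apply: ub_le_sup => //; exists (`|u|^-1 *: u) => //=.
by rewrite normrZ normfV normr_id mulVf// gt_eqF.
Qed.

(** * Riesz representation and the dual norm *)

Section Riesz.
Context {K : realType} {W : completeNormedModType K}.
Variable ip : {dot W for idfun}.
Hypothesis ip_norm : induces_norm ip.

(** The quadratic growth of |v|^2 / 2 - l v at its minimizer p reads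
|p + v|^2 / 2 - l (p + v) >= |p|^2 / 2 - l p + |v|^2 / 2 at the point p + v;
the squares cancel and leave l v <= (p, v).  Applying this to - v gives
equality. *)
Lemma Riesz_representation (l : {linear W -> K^o}) : continuous l ->
  exists r, riesz ip r = l.
Proof.
move=> l_cont.
pose g (v : W) : \bar K := (- (l v : K))%:E.
have gconv : econvex g.
  move=> a u v _; rewrite /g -!EFinM -EFinD lee_fin linearD !linearZ /=.
  by rewrite le_eqVlt; apply/orP; left; apply/eqP; rewrite /GRing.scale /=; ring.
have glsc : lower_semicontinuous g.
  move=> x a; rewrite lte_fin => ax.
  exists [set y | a < - l y] => [|y]; last by rewrite /g lte_fin.
  have nl_cvg : - l y @[y --> x] --> - l x by apply: cvgN; exact: l_cont.
  exact: (cvgr_gt _ nl_cvg).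
have [p p_min] :=
  moreau_has_argmin ip_norm 0 gconv (ltr01 : 0 < 1 :> K) glsc (erefl (g 0)).
have ineq v : l v <= ip p v.
  have := moreau_growth ip_norm gconv ltr01 (p + v) p_min (erefl _).
  rewrite /moreau /g -!EFinD lee_fin !subr0 [p + v - p]addrAC subrr add0r.
  rewrite (sqr_normD ip_norm) linearD /=.
  have -> : (2 * 1)^-1 = 2^-1 :> K by rewrite mulr1.
  lra.
exists p; apply/funext => v; apply/eqP; rewrite eq_le ineq andbT.
by rewrite -lerN2 -ipNr -linearN ineq.
Qed.

(** [riesz_inv] is chosen by [xget], so it is a representative only because one
exists. *)
Lemma hdual_normP (l : {linear W -> K^o}) : continuous l ->
  exists2 r, (forall v, l v = ip r v) & hdual_norm ip l = `|r|.
Proof.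
move=> l_cont.
have rep : [set r | riesz ip r = l] !=set0 by exact: Riesz_representation.
have rE : riesz ip (riesz_inv ip l) = l := xgetPex 0 rep.
by exists (riesz_inv ip l) => // v; rewrite -[RHS]/(riesz ip _ v) rE.
Qed.

End Riesz.

Lemma first_index_exists (P : pred nat) : (exists n, P n) ->
  exists n, first_index P n.
Proof.
move=> exP; exists (ex_minn exP); case: ex_minnP => n Pn n_min.
by split=> // m; rewrite ltnNge; apply: contra => /n_min.
Qed.

(** * Weak duality *)

Section composite.
Context {K : realType} {W X : completeNormedModType K}.
Variables (ip : {dot W for idfun}) (T : {linear W -> X}) (R : X -> \bar K).
Hypotheses (ip_norm : induces_norm ip) (T_bounded : bounded_near T (nbhs 0)).
Hypothesis R_proper : forall x, R x != -oo%E.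

(** Fenchel's inequality for R at T z, then Cauchy-Schwarz and Young's inequality
for mu (T (q - z)) = (r, q - z), with r representing T^* mu. *)
Lemma weak_duality q t mu z : 0 < t ->
  (dual_value ip T R q t mu <= Psi T R q t z)%E.
Proof.
move=> t_gt0; rewrite /Psi; have := R_proper (T z).
case Rz : (R (T z)) => [c| |]// _; last by rewrite addey// leey.
have T_cont : continuous T by exact/linear_bounded_continuous.
have muT_cont : continuous (mu \o T).
  by move=> v; apply: continuous_comp; [exact: T_cont|exact: cdual_continuous].
have [r rP rn] := hdual_normP ip_norm muT_cont.
have conj_ge : (((mu (T z) : K) - c)%:E <= conjugate R mu)%E.
  by apply: ereal_sup_ubound; exists (T z) => //; rewrite Rz.
rewrite /dual_value -[adjoint _ _]/(mu \o T : W -> K) rn.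
apply: le_trans (leeB (lexx _) conj_ge) _.
rewrite -EFinB -EFinD lee_fin.
have /= -> := rP q; have /= -> := rP z.
have cs := Cauchy_Schwarz ip_norm r (q - z).
rewrite ipDr ipNr distrC in cs.
have : 0 <= (2 * t)^-1 * (`|z - q| - t * `|r|) ^+ 2.
  by rewrite mulr_ge0 ?sqr_ge0// ltW// invr_gt0 mulr_gt0.
have -> : (2 * t)^-1 * (`|z - q| - t * `|r|) ^+ 2 =
  (2 * t)^-1 * `|z - q| ^+ 2 - `|r| * `|z - q| + t / 2 * `|r| ^+ 2.
  by field; rewrite gt_eqF.
lra.
Qed.

(** The gap bounds the excess of Psi over its value at any competitor z, in
particular over its minimum. *)
Lemma Psi_le_gap q t y mu a z b : 0 < t ->
  gap ip T R q t y mu \is a fin_num -> (gap ip T R q t y mu <= a%:E)%E ->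
  (Psi T R q t z <= b%:E)%E -> (Psi T R q t y <= (b + a)%:E)%E.
Proof.
move=> t_gt0; rewrite /gap => gap_fin gap_a zb.
have dual_b := le_trans (weak_duality q mu z t_gt0) zb.
move: gap_fin gap_a dual_b.
case: (Psi T R q t y) => [r| |]; case: (dual_value _ _ _ _ _ _) => [s| |]//=.
by rewrite -EFinB !lee_fin => _; lra.
Qed.

(** * The exact proximal step *)

Hypotheses (R_convex : econvex R) (R_lsc : lower_semicontinuous R).
Variables (gradf : W -> W) (w : W) (c0 : K).
Hypothesis phi_w : phi T R w = c0%:E.

Local Notation g := (gradf w).
Local Notation p := (prox_step ip T R gradf w).

Let phi_convex : econvex (phi T R).
Proof. by move=> a u v a01; rewrite /phi linearD !linearZ; exact: R_convex. Qed.

Let phi_lsc : lower_semicontinuous (phi T R).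
Proof.
move=> u a /R_lsc[V VTu aV]; exists (T @^-1` V) => [|v /aV//].
by have /linear_bounded_continuous/(_ u)/(_ V VTu) := T_bounded.
Qed.

(** Completing the square: Psi at w + s is the proximal objective at s plus the
constant t |g|^2 / 2. *)
Lemma Psi_shiftE t s : 0 < t -> Psi T R (w - t *: g) t (w + s) =
  ((ip g s + (2 * t)^-1 * `|s| ^+ 2 + t / 2 * `|g| ^+ 2)%:E + phi T R (w + s)%R)%E.
Proof.
move=> t_gt0; rewrite /Psi; congr (_%:E + _)%E.
have -> : w + s - (w - t *: g) = s + t *: g.
  by rewrite opprB [t *: g - w]addrC addrA [w + s]addrC addrK.
rewrite (sqr_normD ip_norm) ipZr (ipC ip s) normrZ (gtr0_norm t_gt0).
by field; rewrite gt_eqF.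
Qed.

(** Quadratic growth of the proximal objective at p t, written in real numbers;
all later facts on the exact step are instances of it. *)
Lemma prox_step_optimal t : 0 < t -> exists2 c, phi T R (w + p t) = c%:E &
  forall s a, (phi T R (w + s)%R <= a%:E)%E ->
  c + ip g (p t) + (2 * t)^-1 * `|p t| ^+ 2 + (2 * t)^-1 * `|s - p t| ^+ 2 <=
  a + ip g s + (2 * t)^-1 * `|s| ^+ 2.
Proof.
move=> t_gt0; set q := w - t *: g.
have PsiE s : Psi T R q t (w + s) =
    (prox_objective ip T R gradf w t s + (t / 2 * `|g| ^+ 2)%:E)%E.
  by rewrite Psi_shiftE// /prox_objective addeAC -EFinD.
have moreauE y : moreau (phi T R) q t y = Psi T R q t y by [].
have has_argmin : [set s | is_argmin (prox_objective ip T R gradf w t) s] !=set0.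
  have [y y_min] := moreau_has_argmin ip_norm q phi_convex t_gt0 phi_lsc phi_w.
  exists (y - w) => s; have := y_min (w + s).
  by rewrite !moreauE -{1}(subrK w y) (addrC _ w) !PsiE leeD2rE.
have p_min : is_argmin (prox_objective ip T R gradf w t) (p t) := xgetPex 0 has_argmin.
have wp_min : is_argmin (Psi T R q t) (w + p t).
  by move=> y; rewrite -(subrK w y) (addrC _ w) !PsiE leeD2rE.
have := R_proper (T (w + p t)); rewrite -/(phi T R _).
case phi_p : (phi T R (w + p t)) => [c| |]// _; last first.
  by have := wp_min (w + 0); rewrite !Psi_shiftE// phi_p addr0 phi_w addey.
exists c => // s a sa.
have Psi_p : Psi T R q t (w + p t) =
   (ip g (p t) + (2 * t)^-1 * `|p t| ^+ 2 + t / 2 * `|g| ^+ 2 + c)%:E.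
  by rewrite Psi_shiftE// phi_p.
have := moreau_growth ip_norm phi_convex t_gt0 (w + s) wp_min Psi_p.
rewrite moreauE Psi_shiftE// => h.
have := le_trans h (leeD (lexx _) sa); rewrite -EFinD lee_fin.
rewrite opprD addrACA subrr add0r.
lra.
Qed.

(** Adding the growth inequalities at t and t', each tested at the other step,
eliminates phi and grad f.  With Cauchy-Schwarz the sum becomes
(|p t| / t - |p t'| / t') (|p t| - |p t'|) <= 0.  If the first factor were
negative then |p t| < |p t'|, since 1 / t' <= 1 / t, and the product would be
positive. *)
Lemma prox_step_ratio_nonincreasing t t' : 0 < t -> t <= t' ->
  `|p t'| / t' <= `|p t| / t.
Proof.
move=> t_gt0 tt'; have t'_gt0 := lt_le_trans t_gt0 tt'.
have [c phi_c opt] := prox_step_optimal t_gt0.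
have [c' phi_c' opt'] := prox_step_optimal t'_gt0.
have := opt (p t') c'; rewrite phi_c' => /(_ (lexx _)).
have := opt' (p t) c; rewrite phi_c => /(_ (lexx _)).
rewrite (distrC (p t)) (sqr_normB ip_norm).
have cs := Cauchy_Schwarz ip_norm (p t') (p t).
rewrite !invfM.
have : t'^-1 <= t^-1 by rewrite lef_pV2.
have : 0 < t'^-1 by rewrite invr_gt0.
move: cs (normr_ge0 (p t)) (normr_ge0 (p t')).
(* x = |p t|, y = |p t'|, z = (p t', p t), a = 1 / t, b = 1 / t' *)
move: `|p t| `|p t'| (ip (p t') (p t)) (t^-1) (t'^-1) (ip g _) (ip g _).
move=> x y z a b u v.
clear=> cs x0 y0 b0 ba h h'.
have prod_le0 : (a * x - b * y) * (x - y) <= 0.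
  have : (a + b) * z <= (a + b) * (y * x) 
    by rewrite ler_wpM2l// addr_ge0// ltW ?(lt_le_trans b0).
  lra.
rewrite leNgt; apply/negP => lt_xa.
have lt_ax : a * x < b * y by lra.
have ltxy : x < y.
  by rewrite -(ltr_pM2l b0); apply: le_lt_trans lt_ax; exact: ler_wpM2r.
by move: prod_le0; rewrite leNgt nmulr_rgt0 subr_lt0 ?ltxy ?lt_ax.
Qed.

(** Comparing p t with the zero step, and bounding phi below by its linear
minorant, gives |p t|^2 <= t (C + (C + |g|) |p t|). *)
Lemma prox_step_small eps : 0 < eps ->
  exists2 d, 0 < d & forall t, 0 < t < d -> `|p t| < eps.
Proof.
move=> eps_gt0.
have [C C_ge0 minor] := econvex_lsc_minorant phi_convex phi_lsc phi_w.
pose D := C + (C + `|g|) * eps.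
have D_ge0 : 0 <= D by rewrite addr_ge0// mulr_ge0 ?addr_ge0// ltW.
exists (eps ^+ 2 / (D + 1)); first by rewrite divr_gt0 ?exprn_gt0//; lra.
move=> t /andP[t_gt0]; rewrite ltr_pdivlMr => [t_lt|]; last lra.
have [c phi_c opt] := prox_step_optimal t_gt0.
have := opt 0 c0; rewrite addr0 phi_w => /(_ (lexx _)).
have := minor (w + p t); rewrite phi_c lee_fin addrAC subrr add0r.
rewrite sub0r normrN normr0 expr0n /= mulr0 ip0r !addr0.
have := Cauchy_Schwarz ip_norm g (- p t); rewrite ipNr normrN.
move: t_lt t_gt0 D_ge0; rewrite /D => {opt phi_c minor}.
move: (normr_ge0 (p t)) (normr_ge0 g); move: `|p t| `|g| (ip g (p t)) => x G u.
move=> x_ge0 G_ge0 t_lt t_gt0 D_ge0 cs c_ge opt.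
rewrite ltNge; apply/negP => eps_x.
have key : t^-1 * x ^+ 2 <= C + (C + G) * x.
  have tE : (2 * t)^-1 = t^-1 / 2 by rewrite invfM mulrC.
  by move: opt; rewrite tE; lra.
have {}key : x ^+ 2 <= t * (C + (C + G) * x).
  by rewrite -(ler_pM2l (x := t^-1)) ?invr_gt0// mulKf ?gt_eqF.
have x_gt0 : 0 < x by exact: lt_le_trans eps_x.
have : x * (x * eps) <= x * (t * (C + (C + G) * eps)).
  have : t * (C * eps) <= t * (C * x) by rewrite ler_pM2l// ler_wpM2l.
  have : eps * x ^+ 2 <= eps * (t * (C + (C + G) * x)) by rewrite ler_pM2l.
  lra.
rewrite ler_pM2l// => h.
have : eps * eps <= x * eps by rewrite ler_pM2r.
lra.
Qed.

(** * Inexact proximal steps *)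

Section inexact_step.
Variables (t a : K) (y : W) (mu : cdual X).
Hypothesis t_gt0 : 0 < t.
Local Notation q := (w - t *: g).
Local Notation s := (y - w).
Hypothesis gap_fin : gap ip T R q t y mu \is a fin_num.
Hypothesis gap_le : (gap ip T R q t y mu <= a%:E)%E.

(** [Psi_le_gap] at the competitor w + z, after cancelling the constant of
[Psi_shiftE]. *)
Lemma inexact_prox_value z b : (phi T R (w + z)%R <= b%:E)%E ->
  exists2 cs, phi T R y = cs%:E &
  cs + ip g s + (2 * t)^-1 * `|s| ^+ 2 <= b + ip g z + (2 * t)^-1 * `|z| ^+ 2 + a.
Proof.
move=> zb.
have zb' : (Psi T R q t (w + z)%R <=
    (ip g z + (2 * t)^-1 * `|z| ^+ 2 + t / 2 * `|g| ^+ 2 + b)%:E)%E.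
  by rewrite Psi_shiftE// [leRHS]EFinD leeD2l.
have := Psi_le_gap t_gt0 gap_fin gap_le zb'.
have yE : y = w + s by rewrite addrC subrK.
rewrite [in Psi _ _ _ _ _]yE Psi_shiftE// -yE.
have := R_proper (T y); rewrite -/(phi T R y).
case: (phi T R y) => [cs| |]//= _.
by rewrite -EFinD lee_fin => h; exists cs => //; lra.
Qed.

(** Optimality of p t bounds the objective at s below, [inexact_prox_value] with
z = p t bounds it above. *)
Lemma inexact_prox_dist : (2 * t)^-1 * `|s - p t| ^+ 2 <= a.
Proof.
have [c phi_c opt] := prox_step_optimal t_gt0.
have [|cs phi_s] := inexact_prox_value (z := p t) (b := c); first by rewrite phi_c.
have := opt s cs; rewrite [w + s]addrC subrK phi_s => /(_ (lexx _)).
lra.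
Qed.

Variable sigma : K.
Hypotheses (sigma_01 : 0 < sigma < 1).
Hypothesis a_le : a <= sigma ^+ 2 / (2 * t) * `|s| ^+ 2.

Let t2_gt0 : 0 < (2 * t)^-1. Proof. by rewrite invr_gt0 mulr_gt0. Qed.

Lemma accepted_dist : `|s - p t| <= sigma * `|s|.
Proof.
case/andP: sigma_01 => sigma_gt0 _.
rewrite -(ler_pXn2r (n := 2)) ?nnegrE ?mulr_ge0 ?(ltW sigma_gt0)//.
rewrite -(ler_pM2l t2_gt0) (le_trans inexact_prox_dist)// (le_trans a_le)//.
by rewrite exprMn [leRHS]mulrCA -mulrA.
Qed.

Lemma accepted_norm_ge : `|p t| <= (1 + sigma) * `|s|.
Proof.
have := accepted_dist; have := ler_distD s (p t) 0.
rewrite !subr0 distrC; lra.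
Qed.

Lemma accepted_norm_le : (1 - sigma) * `|s| <= `|p t|.
Proof.
have := accepted_dist; have := ler_distD (p t) s 0.
rewrite !subr0; lra.
Qed.

(** The growth inequality at the zero step, the bound |p t| >= (1 - sigma) |s| and
the test give a multiple of |s|^2 / (2 t) with the coefficient
(1 - sigma)^2 + 1 - sigma^2 = 2 (1 - sigma). *)
Lemma accepted_decrease : exists2 cs, phi T R y = cs%:E &
  cs + ip g s + (1 - sigma) / t * `|s| ^+ 2 <= c0.
Proof.
have [c phi_c opt] := prox_step_optimal t_gt0.
have [|cs phi_s cs_le] := inexact_prox_value (z := p t) (b := c).
  by rewrite phi_c.
exists cs => //.
have := opt 0 c0; rewrite addr0 phi_w => /(_ (lexx _)).
rewrite sub0r normrN normr0 expr0n /= mulr0 ip0r !addr0.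
case/andP: sigma_01 => sigma_gt0 sigma_lt1.
have : (2 * t)^-1 * ((1 - sigma) * `|s|) ^+ 2 <= (2 * t)^-1 * `|p t| ^+ 2.
  rewrite ler_pM2l// ler_pXn2r ?nnegrE ?mulr_ge0 ?subr_ge0 ?(ltW sigma_lt1)//.
  exact: accepted_norm_le.
have -> : (1 - sigma) / t * `|s| ^+ 2 = (2 * t)^-1 * ((1 - sigma) * `|s|) ^+ 2
  + (2 * t)^-1 * `|s| ^+ 2 - sigma ^+ 2 / (2 * t) * `|s| ^+ 2.
  by field; rewrite gt_eqF.
by move: a_le cs_le; set u := (2 * t)^-1; lra.
Qed.

End inexact_step.

(** * The geometric search *)

Variables (tau sigma zeta : K) (inner : W -> K -> inner_output W X).
Hypotheses (tau_gt0 : 0 < tau) (sigma_01 : 0 < sigma < 1) (zeta_01 : 0 < zeta < 1).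
Hypothesis innerP : inner_approximation ip T R gradf inner.
Hypothesis chi_gt0 : 0 < chi ip T R gradf tau w.
Variable B : {linear W -> W}.
Hypothesis B_bounded : bounded_near B (nbhs 0).

Local Notation chi_w := (chi ip T R gradf tau w).
Local Notation t_ := (cauchy_param tau sigma zeta B).
Local Notation s_ := (cauchy_step tau sigma zeta inner B w).
Local Notation passes t i := (relative_test sigma w t (inner w t) i).

Let w_dom : edom (phi T R) w. Proof. by rewrite /edom /= phi_w ltry. Qed.
Let sigma_gt0 : 0 < sigma. Proof. by case/andP: sigma_01. Qed.
Let sigma_lt1 : sigma < 1. Proof. by case/andP: sigma_01. Qed.
Let zeta_gt0 : 0 < zeta. Proof. by case/andP: zeta_01. Qed.
Let zeta_lt1 : zeta < 1. Proof. by case/andP: zeta_01. Qed.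
Let opB_gt0 : 0 < 1 + opnorm B. Proof. by have := opnorm_ge0 B_bounded; lra. Qed.

(** This is [prox_step_ratio_nonincreasing] between t and tau. *)
Lemma prox_step_ge t : 0 < t <= tau -> t * chi_w <= `|p t|.
Proof.
case/andP=> t_gt0 t_tau; rewrite mulrC -ler_pdivlMr// /chi [_^-1 * _]mulrC.
exact: (prox_step_ratio_nonincreasing t_gt0 t_tau).
Qed.

(** The iterates tend to w + p t with p t <> 0, so the right-hand side of the test
is eventually at least sigma^2 |p t|^2 / (8 t), a positive number that the gap
bound falls below. *)
Lemma inner_run_stops t : 0 < t <= tau -> exists i, passes t i.
Proof.
move=> t_tau; case/andP: (t_tau) => t_gt0 _.
have p_gt0 : 0 < `|p t| by apply: lt_le_trans (prox_step_ge t_tau); rewrite mulr_gt0.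
have [gap_fin _ gap_le bound_cvg] := innerP w_dom t_gt0.
have eps_gt0 : 0 < sigma ^+ 2 * `|p t| ^+ 2 / (8 * t).
  by rewrite divr_gt0 ?mulr_gt0 ?exprn_gt0.
have [i _ /(_ i (leqnn i)) /= lt_i] := cvgr_lt _ bound_cvg _ eps_gt0.
exists i; rewrite /relative_test.
set a := gap_bound _ _ in lt_i *; set s := _ - w.
have dist : (2 * t)^-1 * `|s - p t| ^+ 2 <= a.
  exact: (inexact_prox_dist t_gt0 (gap_fin i) (gap_le i)).
have close : `|s - p t| <= `|p t| / 2.
  rewrite -(ler_pXn2r (n := 2)) ?nnegrE//.
  have t2_gt0 : 0 < (2 * t)^-1 by rewrite invr_gt0 mulr_gt0.
  rewrite -(ler_pM2l t2_gt0); apply: le_trans dist _; apply: le_trans (ltW lt_i) _.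
  have -> : (2 * t)^-1 * (`|p t| / 2) ^+ 2 = `|p t| ^+ 2 / (8 * t).
    by field; rewrite gt_eqF.
  rewrite ler_pM2r ?invr_gt0 ?mulr_gt0// ler_piMl ?sqr_ge0//.
  by rewrite exprn_ile1 ?ltW.
have s_ge : `|p t| / 2 <= `|s|.
  by have := ler_distD s (p t) 0; rewrite !subr0 distrC; lra.
apply: le_trans (ltW lt_i) _.
have -> : sigma ^+ 2 * `|p t| ^+ 2 / (8 * t) = sigma ^+ 2 / (2 * t) * (`|p t| / 2) ^+ 2.
  by field; rewrite gt_eqF.
rewrite ler_pM2l ?divr_gt0 ?exprn_gt0 ?mulr_gt0//.
by rewrite ler_pXn2r ?nnegrE// ltW// divr_gt0.
Qed.

Lemma cauchy_param_gt0 j : 0 < t_ j.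
Proof.
by rewrite mulr_gt0 ?exprn_gt0// lt_min tau_gt0 divr_gt0// subr_gt0.
Qed.

Lemma cauchy_param_le j : t_ j <= Num.min tau ((1 - sigma) / (1 + opnorm B)).
Proof.
rewrite ler_piMl ?exprn_ile1 ?(ltW zeta_gt0) ?(ltW zeta_lt1)//.
by rewrite le_min (ltW tau_gt0) divr_ge0 ?subr_ge0 ?ltW.
Qed.

Lemma cauchy_param_tau j : 0 < t_ j <= tau.
Proof. by rewrite cauchy_param_gt0 (le_trans (cauchy_param_le j))// ge_min lexx. Qed.

Lemma cauchy_param_small d : 0 < d -> exists j, t_ j < d.
Proof.
move=> d_gt0; have zeta_cvg : (fun j => t_ j) @ \oo --> (0 : K).
  rewrite -(mul0r (Num.min tau ((1 - sigma) / (1 + opnorm B)))).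
  apply: cvgM; last exact: cvg_cst.
  by apply: cvg_expr; rewrite gtr0_norm.
by have [j _ /(_ j (leqnn j))] := cvgr_lt _ zeta_cvg _ d_gt0; exists j.
Qed.

Lemma cauchy_step_accepted j i : passes (t_ j) i ->
  [/\ (1 - sigma) * `|s_ j i| <= `|p (t_ j)|,
      `|p (t_ j)| <= (1 + sigma) * `|s_ j i| &
      exists2 cs, phi T R (w + s_ j i) = cs%:E &
        cs + ip g (s_ j i) + (1 - sigma) / t_ j * `|s_ j i| ^+ 2 <= c0].
Proof.
move=> pass; have t_gt0 := cauchy_param_gt0 j.
have [gap_fin _ gap_le _] := innerP w_dom t_gt0.
split.
- exact: (accepted_norm_le t_gt0 (gap_fin i) (gap_le i) sigma_01 pass).
- exact: (accepted_norm_ge t_gt0 (gap_fin i) (gap_le i) sigma_01 pass).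
- rewrite addrC subrK.
  exact: (accepted_decrease t_gt0 (gap_fin i) (gap_le i) sigma_01 pass).
Qed.

Variable Delta : K.
Hypothesis Delta_gt0 : 0 < Delta.

(** An accepted step has length at most |p t| / (1 - sigma), which falls below
Delta once t is small. *)
Lemma cauchy_search_terminates :
  exists J n, cauchy_search_run tau sigma zeta inner B Delta w J n.
Proof.
have /choice[n nP] : forall j, exists i, first_index (fun i => passes (t_ j) i) i.
  by move=> j; apply/first_index_exists/inner_run_stops/cauchy_param_tau.
have eps_gt0 : 0 < (1 - sigma) * Delta by rewrite mulr_gt0// subr_gt0.
have [d d_gt0 small] := prox_step_small eps_gt0.
have [j tj_lt] := cauchy_param_small d_gt0.
have [|J JP] := @first_index_exists (fun j => `|s_ j (n j)| <= Delta).
  exists j; have [s_le _ _] := cauchy_step_accepted (nP j).1.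
  have := le_lt_trans s_le (small _ _).
  by rewrite cauchy_param_gt0 tj_lt ltr_pM2l ?subr_gt0// => /(_ isT)/ltW.
by exists J, n; split=> // k _; exact: nP.
Qed.

Local Notation min_factor := (Num.min tau (zeta * (1 - sigma))).

Let min_factor_ge0 : 0 <= min_factor.
Proof. by rewrite le_min (ltW tau_gt0) ltW// mulr_gt0// subr_gt0. Qed.

Let radius_ge0 : 0 <= Num.min (chi_w / (1 + opnorm B)) Delta.
Proof. by rewrite le_min divr_ge0 ?ltW. Qed.

(** At J = 0 the parameter is the initial one, which is at least
min_factor / (1 + |B|), and |p t| >= t chi.  At J + 1 the step at parameter J
was longer than Delta, so the exact step there is longer than
(1 - sigma) Delta, and one reduction shrinks the exact step by at most the
factor zeta. *)
Lemma cauchy_step_lower_bound J n :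
  cauchy_search_run tau sigma zeta inner B Delta w J n ->
  min_factor * Num.min (chi_w / (1 + opnorm B)) Delta <= (1 + sigma) * `|s_ J (n J)|.
Proof.
case=> n_first [_ J_min].
have [_ s_ge _] := cauchy_step_accepted (n_first J (leqnn J)).1.
apply: le_trans _ s_ge.
case: J J_min n_first => [|J] J_min n_first.
  apply: le_trans (prox_step_ge (cauchy_param_tau 0)).
  apply: le_trans (_ : min_factor * (chi_w / (1 + opnorm B)) <= _).
    by rewrite ler_wpM2l ?ge_min ?lexx.
  rewrite mulrCA mulrC ler_pM2r// /cauchy_param expr0 mul1r le_min.
  rewrite !ler_pdivrMr// divfK ?gt_eqF//.
  have op_ge0 := opnorm_ge0 B_bounded.
  apply/andP; split.
    by rewrite ge_min ler_peMr ?(ltW tau_gt0)//; lra.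
  by rewrite ge_min; apply/orP; right; rewrite ler_piMl ?subr_ge0 ?ltW.
have rejected := J_min J (ltnSn J); rewrite -ltNge in rejected.
have [s_le _ _] := cauchy_step_accepted (n_first J (leqnSn J)).1.
have tS : t_ J.+1 = zeta * t_ J by rewrite /cauchy_param exprS mulrA.
have tJ_gt0 := cauchy_param_gt0 J.
have tS_le : t_ J.+1 <= t_ J by rewrite tS ler_piMl ?ltW.
have := prox_step_ratio_nonincreasing (cauchy_param_gt0 J.+1) tS_le.
rewrite ler_pdivrMr// [X in _ / X]tS.
have -> : `|p (t_ J.+1)| / (zeta * t_ J) * t_ J = `|p (t_ J.+1)| / zeta.
  by field; rewrite !gt_eqF.
rewrite ler_pdivlMr// => ratio.
apply: le_trans _ ratio.
apply: le_trans (_ : zeta * (1 - sigma) * Delta <= _).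
  by apply: ler_pM; rewrite // ge_min lexx orbT.
rewrite -mulrA [leRHS]mulrC ler_pM2l//; apply: le_trans s_le.
by rewrite ler_pM2l ?subr_gt0// ltW.
Qed.

Variable f : W -> K^o.

(** Half of [accepted_decrease] pays for the curvature of B.  In the other half,
(1 - sigma) |s|^2 / (2 t), one factor |s| / t is at least
chi / (1 + sigma) and the other is bounded by [cauchy_step_lower_bound]. *)
Lemma pred_decrease_ge J n : cauchy_search_run tau sigma zeta inner B Delta w J n ->
  edom (phi T R) (w + s_ J (n J)) /\
  ((kappa_C tau sigma zeta * chi_w * Num.min (chi_w / (1 + opnorm B)) Delta)%:E
    <= pred_decrease ip T R f gradf B w (s_ J (n J)))%E.
Proof.
move=> run; have s_min := cauchy_step_lower_bound run.
have [_ s_ge [cs phi_s decr]] := cauchy_step_accepted (run.1 J (leqnn J)).1.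
set s := s_ J (n J) in s_min s_ge phi_s decr *.
split; first by rewrite /edom /= phi_s ltry.
have t_gt0 := cauchy_param_gt0 J; set t := t_ J in t_gt0 s_ge decr.
rewrite /pred_decrease /model addr0 phi_w phi_s -!EFinD lee_fin.
rewrite !ip0r mulr0.
have curv : 2^-1 * ip (B s) s <= (1 - sigma) / t * `|s| ^+ 2 / 2.
  rewrite [leRHS]mulrC ler_pM2l//.
  apply: le_trans (Cauchy_Schwarz ip_norm _ _) _.
  rewrite expr2 mulrA ler_wpM2r//; apply: le_trans (opnorm_ge s B_bounded) _.
  rewrite ler_wpM2r// ler_pdivlMr//.
  have := cauchy_param_le J; rewrite le_min => /andP[_]; rewrite ler_pdivlMr// -/t.
  by have := t_gt0; lra.
have ratio : chi_w <= (1 + sigma) * `|s| / t.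
  rewrite ler_pdivlMr// mulrC.
  exact: le_trans (prox_step_ge (cauchy_param_tau J)) s_ge.
set M := Num.min _ Delta in s_min *.
have main : kappa_C tau sigma zeta * chi_w * M <= (1 - sigma) / t * `|s| ^+ 2 / 2.
  have -> : kappa_C tau sigma zeta * chi_w * M =
     (1 - sigma) / (2 * (1 + sigma) ^+ 2) * (chi_w * (min_factor * M)).
    by rewrite /kappa_C; field; rewrite gt_eqF// addr_gt0.
  have -> : (1 - sigma) / t * `|s| ^+ 2 / 2 = (1 - sigma) / (2 * (1 + sigma) ^+ 2) *
    ((1 + sigma) * `|s| / t * ((1 + sigma) * `|s|)).
    by field; rewrite !gt_eqF// addr_gt0.
  rewrite ler_pM2l; last first.
    by rewrite divr_gt0 ?subr_gt0// mulr_gt0// exprn_gt0// addr_gt0.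
  by apply: ler_pM => //; [exact: ltW|exact: mulr_ge0].
by move: main curv decr; set v := (1 - sigma) / t * `|s| ^+ 2; set m := _ * M; lra.
Qed.

End composite.

Theorem theorem4p2 (K : realType) (W X : completeNormedModType K)
  (ip : {dot W for idfun}) (ip_norm : induces_norm ip)
  (T : {linear W -> X}) (T_bounded : bounded_near T (nbhs 0))
  (R : X -> \bar K) (R_proper : proper_fun R) (R_convex : econvex R)
  (R_lsc : lower_semicontinuous R)
  (phi_dom : edom (phi T R) !=set0)
  (f : W -> K^o) (f_C1 : continuously_differentiable f)
  (gradf : W -> W) (gradfP : is_gradient ip f gradf)
  (Lf : K) (Lf_ge0 : 0 <= Lf) (gradf_lip : Lf.-lipschitz gradf)
  (Flow : K)
  (F_bounded : forall w, edom (phi T R) w -> (Flow%:E <= (f w : K)%:E + phi T R w)%E)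
  (tau sigma zeta : K) (tau_gt0 : 0 < tau)
  (sigma_01 : 0 < sigma < 1) (zeta_01 : 0 < zeta < 1)
  (inner : W -> K -> inner_output W X)
  (innerP : inner_approximation ip T R gradf inner)
  (w : W) (w_dom : edom (phi T R) w)
  (chi_gt0 : 0 < chi ip T R gradf tau w)
  (B : {linear W -> W}) (B_bounded : bounded_near B (nbhs 0))
  (B_self_adjoint : self_adjoint ip B)
  (Delta : K) (Delta_gt0 : 0 < Delta) :
  [/\ exists J n, cauchy_search_run tau sigma zeta inner B Delta w J n,
      forall J n, cauchy_search_run tau sigma zeta inner B Delta w J n ->
        let sC := cauchy_step tau sigma zeta inner B w J (n J) in
        edom (phi T R) (w + sC) /\
        ((kappa_C tau sigma zeta * chi ip T R gradf tau w *
            Num.min (chi ip T R gradf tau w / (1 + opnorm B)) Delta)%:E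
         <= pred_decrease ip T R f gradf B w sC)%E
    & 0 < kappa_C tau sigma zeta].
Proof.
have [R_nNy _] := R_proper.
have [c0 phi_w] : exists c0, phi T R w = c0%:E.
  move: w_dom (R_nNy (T w)); rewrite /edom /= -/(phi T R w).
  by case: (phi T R w) => // c0 _ _; exists c0.
split.
- exact: (cauchy_search_terminates ip_norm T_bounded R_nNy R_convex R_lsc phi_w
    tau_gt0 sigma_01 zeta_01 innerP chi_gt0 B_bounded Delta_gt0).
- move=> J n run.
  exact: (pred_decrease_ge ip_norm T_bounded R_nNy R_convex R_lsc phi_w
    tau_gt0 sigma_01 zeta_01 innerP chi_gt0 B_bounded Delta_gt0 f run).
- case/andP: sigma_01 => sigma_gt0 sigma_lt1; case/andP: zeta_01 => zeta_gt0 _.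
  have factor_gt0 : 0 < Num.min tau (zeta * (1 - sigma)).
    by rewrite lt_min tau_gt0 mulr_gt0// subr_gt0.
  apply: divr_gt0; first by rewrite mulr_gt0// subr_gt0.
  by rewrite mulr_gt0// exprn_gt0// addr_gt0.
Qed.
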